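(* Let $n\ge 0$ be an integer and $N=2^n$. For every integer $k$ with $0\le k<N$, $$a_n(k)\,\mathbb E_k A = a_n(k+1)\,\mathbb E_{k+1}R .$$ Consequently, $$\frac{a_n(k+1)}{a_n(k)}=\frac{\mathbb E_k A}{\mathbb E_{k+1}R}\qquad(0\le k<N).$$ Hence the averages $\mathbb E_kA$ $(0\le k<N)$ and $\mathbb E_kR$ $(1\le k\le N)$ determine the whole sequence $(a_n(k))_{k=0}^{N}$ through $$a_n(0)=1,\qquad a_n(k+1)=a_n(k)\,\frac{\mathbb E_k A}{\mathbb E_{k+1}R}\quad(0\le k<N).$$ Equivalently, for $0\le k\le N$, $$a_n(k)=\prod_{j=0}^{k-1}\frac{\mathbb E_j A}{\mathbb E_{j+1}R},\qquad\text{and}\qquad M(n)=\sum_{k=0}^{N}a_n(k).$$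
   Context: Let $B_n=\{0,1\}^n$ with the coordinatewise order $\preceq$ (so $x\preceq y$ iff $x_i\le y_i$ for all $i$), and $N=|B_n|=2^n$. A subset $D\subseteq B_n$ is a downset if $x\in D$ and $y\preceq x$ imply $y\in D$. The Dedekind number $M(n)$ is the number of downsets of $B_n$. For $0\le k\le N$ let $\Omega_{n,k}$ be the set of downsets $D\subseteq B_n$ with $|D|=k$, and $a_n(k)=|\Omega_{n,k}|$. For a downset $D$ let $A(D)=\#\{x\in B_n\setminus D: D\cup\{x\}\text{ is a downset}\}$ and $R(D)=\#\{x\in D: D\setminus\{x\}\text{ is a downset}\}$. For a function $F:\Omega_{n,k}\to\mathbb R$, $\mathbb E_kF=\frac1{a_n(k)}\sum_{D\in\Omega_{n,k}}F(D)$ is its average under the uniform distribution on $\Omega_{n,k}$. Empty products equal $1$. *)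

(* Defs.v *)
From mathcomp Require Import all_boot all_order all_algebra.

Set Implicit Arguments.
Unset Strict Implicit.
Unset Printing Implicit Defensive.

Import Order.TTheory GRing.Theory Num.Theory.
Local Open Scope ring_scope.

Definition cube (n : nat) : finType := {ffun 'I_n -> bool}.

Definition cube_le (n : nat) (x y : cube n) : bool :=
  [forall i : 'I_n, (x i <= y i)%N].

Definition downset (n : nat) (D : {set cube n}) : bool :=
  [forall x in D, forall y : cube n, cube_le y x ==> (y \in D)].

Definition dedekind (n : nat) : nat := #|[set D : {set cube n} | downset D]|.

Definition Omega (n k : nat) : {set {set cube n}} :=
  [set D : {set cube n} | downset D & #|D| == k].

Definition a (n k : nat) : nat := #|Omega n k|.

Definition addable (n : nat) (D : {set cube n}) : nat :=
  #|[set x : cube n | (x \notin D) && downset (x |: D)]|.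

Definition removable (n : nat) (D : {set cube n}) : nat :=
  #|[set x in D | downset (D :\ x)]|.

(* F is a function on all subsets of the cube, but only its restriction to
   Omega n k matters. If Omega n k were empty, the value would be 0. *)
Definition expect (R : realFieldType) (n k : nat) (F : {set cube n} -> R) : R :=
  (a n k)%:R^-1 * \sum_(D in Omega n k) F D.

Definition EA (R : realFieldType) (n k : nat) : R :=
  expect k (fun D : {set cube n} => (addable D)%:R).

Definition ER (R : realFieldType) (n k : nat) : R :=
  expect k (fun D : {set cube n} => (removable D)%:R).

(* Main.v *)
Require Import Defs.
From mathcomp Require Import all_boot all_order all_algebra.

Set Implicit Arguments.
Unset Strict Implicit.
Unset Printing Implicit Defensive.

Import Order.TTheory GRing.Theory Num.Theory.
Local Open Scope ring_scope.

(* Both averages count, up to normalization, the covering pairs D < x |: D of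
   downsets of sizes k and k+1. The ratios make sense because a downset other
   than the full cube can be extended by any minimal element of its
   complement, so every level has a covering pair. *)

Section Downsets.

Variable n : nat.
Implicit Types (D E : {set cube n}) (x y z : cube n).

Lemma card_cube : #|cube n| = (2 ^ n)%N.
Proof. by rewrite card_ffun card_bool card_ord. Qed.

Lemma cube_le_refl x : cube_le x x.
Proof. exact/forallP. Qed.

Lemma cube_le_trans y x z : cube_le x y -> cube_le y z -> cube_le x z.
Proof.
move=> /forallP xy /forallP yz; apply/forallP => i.
exact: leq_trans (xy i) (yz i).
Qed.

Lemma cube_le_anti x y : cube_le x y -> cube_le y x -> x = y.
Proof.
move=> /forallP xy /forallP yx; apply/ffunP => i.
by move: (xy i) (yx i); case: (x i); case: (y i).
Qed.

Lemma downsetP D :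
  reflect (forall x y, x \in D -> cube_le y x -> y \in D) (downset D).
Proof.
apply: (iffP forall_inP) => [dD x y xD | dD x xD].
  by move/forallP: (dD x xD) => /(_ y) /implyP.
by apply/forallP => y; apply/implyP; apply: dD.
Qed.

(** By antisymmetry [x] lies in its own principal downset but not in that of [y]. Thus the size of
    the principal downset is a strictly monotone rank, which turns minimality into minimization of a
    number. *)
Lemma card_below_lt x y :
  cube_le y x -> y != x ->
  (#|[set z | cube_le z y]| < #|[set z | cube_le z x]|)%N.
Proof.
move=> yx neq_yx; apply: proper_card; apply/properP; split.
  by apply/subsetP => z; rewrite !inE => /cube_le_trans; apply.
exists x; rewrite inE ?cube_le_refl //.
by apply: contra neq_yx => xy; apply/eqP/cube_le_anti.
Qed.

Lemma addable_gt0 D : downset D -> (#|D| < 2 ^ n)%N -> (0 < addable D)%N.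
Proof.
move=> /downsetP dD ltD.
have [x0 x0D] : exists x0, x0 \notin D.
  apply/existsP; rewrite -negb_forall; apply: contraL ltD => /forallP allD.
  by rewrite -card_cube -leqNgt; apply/subset_leq_card/subsetP.
(* Minimizing the rank over the complement of [D] yields a minimal element [x] of that
   complement. *)
case:
  (@arg_minnP _ x0 [pred x | x \notin D] (fun x => #|[set z | cube_le z x]|) x0D)
  => x /= xD min_x.
apply/card_gt0P; exists x; rewrite inE xD /=.
apply/downsetP => y z /setU1P[-> zx | yD zy]; last by rewrite inE (dD y z) ?orbT.
rewrite !inE; have [//|neq_zx] := eqVneq z x.
(* A point [z] strictly below [x] and outside [D] would have smaller rank than the minimizer [x]. *)
apply: contraLR (card_below_lt zx neq_zx) => zD.
by rewrite -leqNgt min_x.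
Qed.

Lemma in_Omega k D : (D \in Omega n k) = downset D && (#|D| == k).
Proof. by rewrite inE. Qed.

Lemma a0 : a n 0 = 1%N.
Proof.
rewrite /a (_ : Omega n 0 = [set set0]) ?cards1 //.
apply/setP => D; rewrite in_Omega inE cards_eq0.
have [->|_] := eqVneq D set0; last by rewrite andbF.
by rewrite andbT; apply/downsetP => x y; rewrite inE.
Qed.

(** Starting from the empty downset, points are added one at a time until the cube is full. This
    nonemptiness makes every average below a genuine one. *)
Lemma a_gt0 k : (k <= 2 ^ n)%N -> (0 < a n k)%N.
Proof.
elim: k => [|k IHk] lt_k; first by rewrite a0.
have /card_gt0P[D] := IHk (ltnW lt_k).
rewrite in_Omega => /andP[dD /eqP cD].
have /card_gt0P[x] : (0 < addable D)%N by rewrite addable_gt0 ?cD.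
rewrite inE => /andP[xD dxD].
by apply/card_gt0P; exists (x |: D); rewrite in_Omega dxD cardsU1 xD cD /=.
Qed.

(** Double counting: after summing over the point [x] first, [D] and [x |: D] correspond bijectively
    for each fixed [x], with inverse [E :\ x]. *)
Lemma sum_addable_removable k :
  (\sum_(D in Omega n k) addable D = \sum_(D in Omega n k.+1) removable D)%N.
Proof.
under eq_bigr do rewrite /addable -sum1_card.
under [RHS]eq_bigr do rewrite /removable -sum1_card.
rewrite (exchange_big_dep predT) // [RHS](exchange_big_dep predT) //=.
apply: eq_bigr => x _; rewrite !sum1dep_card.
rewrite -(@card_in_imset _ _ (fun D => x |: D)).
  apply: eq_card => E; apply/imsetP/idP => [[D]|].
    rewrite !inE => /andP[/andP[dD /eqP cD] /andP[xD dxD]] ->.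
    by rewrite !inE eqxx dxD cardsU1 xD cD eqxx setU1K.
  rewrite !inE => /andP[/andP[dE /eqP cE] /andP[xE dEx]].
  exists (E :\ x); last by rewrite setD1K.
  rewrite !inE eqxx dEx setD1K // dE andbT /=.
  by rewrite -eqSS -cE (cardsD1 x E) xE eqxx.
move=> D E; rewrite !inE => /andP[_ /andP[xD _]] /andP[_ /andP[xE _]] eqDE.
by rewrite -(setU1K xD) eqDE setU1K.
Qed.

Lemma dedekind_sum : dedekind n = (\sum_(0 <= k < (2 ^ n).+1) a n k)%N.
Proof.
rewrite /dedekind -sum1_card big_mkord.
(* Sizes run from 0 to [2 ^ n] inclusive, hence the successor in the ordinal indexing the
   partition. *)
have le_card D : (#|D| < (2 ^ n).+1)%N by rewrite ltnS -card_cube max_card.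
rewrite (partition_big (fun D => Ordinal (le_card D)) predT) //=.
apply: eq_bigr => k _; rewrite sum1dep_card /a.
by apply: eq_card => D; rewrite !inE.
Qed.

Variable R : realFieldType.

Lemma a_expect k (F : {set cube n} -> R) :
  (k <= 2 ^ n)%N -> (a n k)%:R * expect k F = \sum_(D in Omega n k) F D.
Proof. by move=> le_k; rewrite mulVKf // pnatr_eq0 -lt0n a_gt0. Qed.

Lemma a_EA k :
  (k < 2 ^ n)%N -> (a n k)%:R * EA R n k = (a n k.+1)%:R * ER R n k.+1.
Proof.
move=> lt_k; rewrite (a_expect _ (ltnW lt_k)) (a_expect _ lt_k) -!natr_sum.
by rewrite sum_addable_removable.
Qed.

Lemma EA_neq0 k : (k < 2 ^ n)%N -> EA R n k != 0.
Proof.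
move=> lt_k; have a_k := a_gt0 (ltnW lt_k).
suff: (a n k)%:R * EA R n k != 0 by rewrite mulf_eq0 negb_or => /andP[].
rewrite a_expect 1?ltnW //= -natr_sum pnatr_eq0 -lt0n.
have /card_gt0P[D DO] := a_k; rewrite (bigD1 D) //= addn_gt0.
by move: DO; rewrite in_Omega => /andP[dD /eqP cD]; rewrite addable_gt0 ?cD.
Qed.

(** Nonvanishing passes from [EA] at level [k] through the identity [a_EA], so no removable point
    has to be exhibited. *)
Lemma ER_neq0 k : (k < 2 ^ n)%N -> ER R n k.+1 != 0.
Proof.
move=> lt_k; have: (a n k)%:R * EA R n k != 0.
  by rewrite mulf_neq0 ?EA_neq0 // pnatr_eq0 -lt0n a_gt0 // ltnW.
by rewrite a_EA // mulf_eq0 negb_or => /andP[].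
Qed.

Lemma a_succ k :
  (k < 2 ^ n)%N -> (a n k.+1)%:R = (a n k)%:R * (EA R n k / ER R n k.+1).
Proof. by move=> lt_k; rewrite mulrA a_EA // mulfK ?ER_neq0. Qed.

Lemma a_unique (b : nat -> R) :
  b 0%N = 1 ->
  (forall k, (k < 2 ^ n)%N -> b k.+1 = b k * (EA R n k / ER R n k.+1)) ->
  forall k, (k <= 2 ^ n)%N -> b k = (a n k)%:R.
Proof.
move=> b0 bS; elim=> [|k IHk] lt_k; first by rewrite b0 a0.
by rewrite bS // IHk 1?ltnW // a_succ.
Qed.

End Downsets.

Theorem theorem1 (R : realFieldType) (n : nat) :
  let N := (2 ^ n)%N in
  [/\ #|cube n| = N,
      forall k : nat, (k < N)%N ->
        (a n k)%:R * EA R n k = (a n k.+1)%:R * ER R n k.+1,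
      forall k : nat, (k < N)%N ->
        [/\ (a n k)%:R != 0 :> R, ER R n k.+1 != 0 &
            (a n k.+1)%:R / (a n k)%:R = EA R n k / ER R n k.+1]
    & [/\ a n 0 = 1%N
           /\ (forall k : nat, (k < N)%N ->
                 (a n k.+1)%:R = (a n k)%:R * (EA R n k / ER R n k.+1)),
          (forall b : nat -> R,
             b 0%N = 1 ->
             (forall k : nat, (k < N)%N ->
                b k.+1 = b k * (EA R n k / ER R n k.+1)) ->
             forall k : nat, (k <= N)%N -> b k = (a n k)%:R),
          (forall k : nat, (k <= N)%N ->
             (a n k)%:R = \prod_(0 <= j < k) (EA R n j / ER R n j.+1))
        & dedekind n = (\sum_(0 <= k < N.+1) a n k)%N]].
Proof.
move=> N; split; [exact: card_cube | exact: a_EA | move=> k lt_k | split].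
- have a_neq0 : (a n k)%:R != 0 :> R by rewrite pnatr_eq0 -lt0n a_gt0 // ltnW.
  by split; rewrite ?ER_neq0 // a_succ // mulrC mulKf.
- by split; [exact: a0 | exact: a_succ].
- exact: a_unique.
(* The partial products satisfy the same initial value and recursion, so uniqueness identifies them
   with [a n k]. *)
- move=> k le_k; apply/esym; move: k le_k; apply: a_unique => [|k _].
    by rewrite big_geq.
  by rewrite big_nat_recr.
- exact: dedekind_sum.
Qed.
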